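(* The Laplace transform $\psi(s)=\mathbb{E}[e^{-sS^*}]$ of the stationary sojourn time $S^*$ is given, for $s\ge 0$, by $$ \psi(s)=\pi_0\sum_{h=0}^{K-1}\left[\left(\frac{\lambda}{\mu_0}\right)^h\psi(h+1,0,s)+\left(\frac{\lambda}{\mu_0}\right)^K\left(\frac{\lambda}{\mu_1}\right)^h\left(\frac{\mu_1}{\mu_1+s}\right)^{h+1}\psi(K,h,s)\right] +\pi_0\left(\frac{\lambda}{\mu_0}\right)^K\left(\frac{\lambda}{\mu_1}\right)^K\frac{\mu_1}{\mu_1-\lambda}\left(\frac{\mu_1}{\mu_1+s}\right)^{2K}\frac{\mu_1-\lambda}{\mu_1-\lambda+s}. $$
   Context: Model (continuous inspection). Let $\lambda>0$, $0<\mu_0<\mu_1$, let $K\ge 1$ be an integer, and assume stability $\lambda<\mu_1$. Customers arrive to a single-server queue according to a Poisson process of rate $\lambda$, have i.i.d. exponential service requirements of mean $1$, and are served in order of arrival. At any time the server works at rate $\mu_0$ if the number of customers in the system is at most $K$, and at rate $\mu_1$ if it is larger than $K$ (the rate changes immediately when the threshold is crossed). So the number of customers is a birth-death process with birth rate $\lambda$ in every state, death rate $\mu_0$ in states $1,\dots,K$ and death rate $\mu_1$ in states $n>K$. Its stationary distribution is $\pi_n=(\lambda/\mu_0)^n\pi_0$ for $n\le K$ and $\pi_n=(\mu_1/\mu_0)^K(\lambda/\mu_1)^n\pi_0$ for $n>K$, with $$\pi_0=\left(\sum_{n=0}^K(\lambda/\mu_0)^n+\frac{\lambda}{\mu_1-\lambda}(\lambda/\mu_0)^K\right)^{-1}.$$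 For $n\ge 0$, $m\ge 0$, $S(n,m)$ denotes the remaining sojourn time of a tagged customer who is at position $n$ in the system (position $1$ is the customer in service) and has $m$ customers behind him; $S(0,m)=0$. Equivalently, $S(n,m)$ is the time for the continuous-time Markov chain on pairs $(n,m)$ with transitions $(n,m)\to(n-1,m)$ at rate $\mu_0$ if $n+m\le K$ and $\mu_1$ if $n+m>K$, and $(n,m)\to(n,m+1)$ at rate $\lambda$ (for $n\ge 1$), started at $(n,m)$, to have its first coordinate reach $0$. Put $\psi(n,m,s)=\mathbb{E}[e^{-sS(n,m)}]$. $S^*$ is the sojourn time of a customer arriving to the system in stationarity; by PASTA its law is the mixture of the laws of $S(n+1,0)$ with weights $\pi_n$, i.e. $\psi(s)=\mathbb{E}[e^{-sS^*}]=\sum_{n=0}^\infty\psi(n+1,0,s)\,\pi_n$. *)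

(* Defs.v *)
From HB Require Import structures.
From mathcomp Require Import all_boot all_order all_algebra.
From mathcomp Require Import ring zify.
From mathcomp Require Import all_classical all_reals all_analysis.
From mathcomp Require Import measurable_realfun.
Set Implicit Arguments.
Unset Strict Implicit.
Unset Printing Implicit Defensive.
Import Order.TTheory GRing.Theory Num.Theory.
Import numFieldNormedType.Exports.
Local Open Scope classical_set_scope.
Local Open Scope ring_scope.

(* Continuous-time Markov chains on a countable type E.  A generator is a
   Q-matrix Q : E -> E -> R with off-diagonal entries the transition rates and
   Q x x = - (total rate out of x). *)
Section MarkovChain.
Context (R : realType) (E : countType).

Definition exit_rate (Q : E -> E -> R) (x : E) : R := - Q x x.

(* Absorbing states (exit rate 0) jump to themselves, after an infinite holding
   time. *)
Definition jump_prob (Q : E -> E -> R) (x y : E) : R :=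
  if exit_rate Q x == 0 then (x == y)%:R
  else if x == y then 0 else Q x y / exit_rate Q x.

Context (d : measure_display) (Omega : measurableType d)
  (P : probability Omega R).

Definition jump_time (T : nat -> Omega -> \bar R) (k : nat) (w : Omega) :
  \bar R := (\sum_(i < k) T i w)%E.

(* Y is a discrete-time Markov chain with initial law nu and transition matrix
   jump_prob Q and, given Y, the holding times T i are independent and
   exponential with rate exit_rate Q (Y i): the joint law of
   (Y_0, T_0, ..., Y_k, T_k) is given through its survival function. *)
Definition jump_holding_law (nu : E -> R) (Q : E -> E -> R)
    (Y : nat -> Omega -> E) (T : nat -> Omega -> \bar R) : Prop :=
  [/\ forall k x, measurable [set w | Y k w = x],
      forall k, measurable_fun [set: Omega] (T k) &
      forall (k : nat) (y : nat -> E) (t : nat -> R), (forall i, 0 <= t i) ->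
        P [set w | forall i, (i <= k)%N -> Y i w = y i /\ ((t i)%:E < T i w)%E]
        = (nu (y 0%N) * (\prod_(i < k) jump_prob Q (y i) (y i.+1))
           * \prod_(i < k.+1) expR (- (exit_rate Q (y i) * t i)))%:E].

(* The path X is the step function equal to Y k between the k-th and the k+1-st
   jump times; its values after a possible explosion are left free. *)
Definition markov_chain (nu : E -> R) (Q : E -> E -> R)
    (X : R -> Omega -> E) : Prop :=
  exists (Y : nat -> Omega -> E) (T : nat -> Omega -> \bar R),
    jump_holding_law nu Q Y T /\
    {ae P, forall w, forall (k : nat) (t : R),
      (jump_time T k w <= t%:E)%E -> (t%:E < jump_time T k.+1 w)%E ->
      X t w = Y k w}.

Definition hitting_time (X : R -> Omega -> E) (A : set E) (w : Omega) :
  \bar R := ereal_inf [set t%:E | t in [set t : R | 0 <= t /\ A (X t w)]].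

End MarkovChain.

Definition point_mass (R : realType) (E : eqType) (x y : E) : R := (x == y)%:R.

(* The service rate when there are j customers in the system. *)
Definition service_rate (R : realType) (mu0 mu1 : R) (K j : nat) : R :=
  if (j <= K)%N then mu0 else mu1.

(* Pairs are (position of the tagged customer, number of customers behind
   him); the states (0, m) are absorbing. *)
Definition tagged_gen (R : realType) (lam mu0 mu1 : R) (K : nat)
    (x y : nat * nat) : R :=
  let: (n, m) := x in
  if n is n'.+1 then
    if y == (n', m) then service_rate mu0 mu1 K (n + m)
    else if y == (n, m.+1) then lam
    else if y == x then - (lam + service_rate mu0 mu1 K (n + m))
    else 0
  else 0.

(* S is only required to agree almost surely with the hitting time, which
   need not be measurable on the null set where the path is unconstrained. *)
Definition remaining_sojourn_time (R : realType) (d : measure_display)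
    (Omega : measurableType d) (P : probability Omega R)
    (lam mu0 mu1 : R) (K n m : nat) (S : {RV P >-> \bar R}) : Prop :=
  exists X : R -> Omega -> nat * nat,
    markov_chain P (point_mass R (n, m)) (tagged_gen lam mu0 mu1 K) X /\
    {ae P, forall w, S w = hitting_time X [set x | x.1 = 0%N] w}.

(* stat_dist is the stationary distribution of the number of customers in the
   system; see stat_dist_ge0, stat_dist_sum1 and stat_dist_stationary. *)
Definition pi0 (R : realType) (lam mu0 mu1 : R) (K : nat) : R :=
  (\sum_(0 <= n < K.+1) (lam / mu0) ^+ n
   + lam / (mu1 - lam) * (lam / mu0) ^+ K)^-1.

Definition stat_dist (R : realType) (lam mu0 mu1 : R) (K n : nat) : R :=
  if (n <= K)%N then (lam / mu0) ^+ n * pi0 lam mu0 mu1 K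
  else (mu1 / mu0) ^+ K * (lam / mu1) ^+ n * pi0 lam mu0 mu1 K.

(* By PASTA, the law of the stationary sojourn time is the mixture of the laws
   of S(n + 1, 0) with weights the stationary distribution. *)
Definition stationary_sojourn_time (R : realType) (d : measure_display)
    (Omega : measurableType d) (P : probability Omega R)
    (lam mu0 mu1 : R) (K : nat)
    (S : nat -> nat -> {RV P >-> \bar R}) (Sstar : {RV P >-> \bar R}) : Prop :=
  forall B : set (\bar R), measurable B ->
    distribution P Sstar B =
    (\sum_(0 <= n <oo)
       (stat_dist lam mu0 mu1 K n)%:E * distribution P (S n.+1 0%N) B)%E.

(* E[exp (- s Z)], with exp (- oo) = 0. *)
Definition laplace (R : realType) (d : measure_display)
    (Omega : measurableType d) (P : probability Omega R)
    (Z : {RV P >-> \bar R}) (s : R) : \bar R :=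
  (\int[P]_w expeR (- (s%:E * Z w)))%E.

(* Generator of the number of customers in the system. *)
Definition queue_gen (R : realType) (lam mu0 mu1 : R) (K : nat)
    (i j : nat) : R :=
  if j == i.+1 then lam
  else if i == j.+1 then service_rate mu0 mu1 K i
  else if i == j then
    - (lam + (if i is 0 then 0 else service_rate mu0 mu1 K i))
  else 0.

Section StatDist.
Context (R : realType) (lam mu0 mu1 : R) (K : nat).
Hypotheses (lam_gt0 : 0 < lam) (mu0_gt0 : 0 < mu0) (lam_lt : lam < mu1).

Let mu1_gt0 : 0 < mu1. Proof. exact: lt_trans lam_gt0 lam_lt. Qed.

Lemma pi0_gt0 : 0 < pi0 lam mu0 mu1 K.
Proof.
rewrite invr_gt0 ltr_wpDl ?sumr_ge0// => [i _|].
  by rewrite exprn_ge0// divr_ge0// ltW.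
by rewrite mulr_gt0 ?exprn_gt0 ?divr_gt0 ?subr_gt0.
Qed.

Lemma stat_dist_ge0 n : 0 <= stat_dist lam mu0 mu1 K n.
Proof.
rewrite /stat_dist; case: ifP => _;
  by rewrite !mulr_ge0 ?exprn_ge0 ?divr_ge0// ltW// pi0_gt0.
Qed.

Lemma stat_dist_balance n :
  stat_dist lam mu0 mu1 K n * lam =
  stat_dist lam mu0 mu1 K n.+1 * service_rate mu0 mu1 K n.+1.
Proof.
have m0 : mu0 != 0 by rewrite gt_eqF.
have m1 : mu1 != 0 by rewrite gt_eqF.
rewrite /stat_dist /service_rate; case: (ltngtP n K) => [nK|nK|->].
- by rewrite exprS; field.
- by rewrite exprS; field.
- rewrite exprS !expr_div_n; field.
  by rewrite ?m0 ?m1 ?expf_neq0.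
Qed.

Lemma stat_dist_stationary j :
  series (fun i => stat_dist lam mu0 mu1 K i * queue_gen lam mu0 mu1 K i j) n
    @[n --> \oo] --> (0 : R).
Proof.
rewrite -(cvg_shiftn j.+2) /=; apply: cvg_near_cst; apply: nearW => n.
rewrite /series /= addnC (big_cat_nat (n := j.+2))//= ?leq_addr//.
rewrite [X in _ + X]big_nat_cond [X in _ + X]big1 ?addr0; last first.
  move=> i; rewrite andbT => /andP[ji _].
  rewrite /queue_gen ifN ?ifN ?ifN ?mulr0//; apply/eqP; lia.
case: j => [|j].
  rewrite big_ltn// big_nat1 /queue_gen /= -stat_dist_balance.
  by ring.
rewrite (big_nat_recr j.+2)// (big_nat_recr j.+1)// (big_nat_recr j)//=.
rewrite big_nat_cond big1 ?add0r => [|i]; last first.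
  rewrite andbT => /andP[_ ji].
  rewrite /queue_gen ifN ?ifN ?ifN ?mulr0//; apply/eqP; lia.
have -> : queue_gen lam mu0 mu1 K j j.+1 = lam by rewrite /queue_gen eqxx.
have -> : queue_gen lam mu0 mu1 K j.+1 j.+1 =
    - (lam + service_rate mu0 mu1 K j.+1).
  rewrite /queue_gen ifN; last by apply/eqP; lia.
  by rewrite ifN ?eqxx//; apply/eqP; lia.
have -> : queue_gen lam mu0 mu1 K j.+2 j.+1 = service_rate mu0 mu1 K j.+2.
  by rewrite /queue_gen ifN ?eqxx//; apply/eqP; lia.
have b1 := stat_dist_balance j.+1; have b0 := stat_dist_balance j.
by rewrite -b1 mulrN mulrDr -b0; ring.
Qed.

Lemma stat_dist_sum1 :
  series (stat_dist lam mu0 mu1 K) n @[n --> \oo] --> (1 : R).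
Proof.
have m0 : mu0 != 0 by rewrite gt_eqF.
have m1 : mu1 != 0 by rewrite gt_eqF.
have m1l : mu1 - lam != 0 by rewrite gt_eqF// subr_gt0.
have pi0N := gt_eqF pi0_gt0.
set p := pi0 lam mu0 mu1 K in pi0N.
rewrite -(cvg_shiftn K.+1) /=.
rewrite (_ : (fun n => _) = fun n =>
  1 - p * (lam / mu0) ^+ K * (lam / (mu1 - lam)) * (lam / mu1) ^+ n); last first.
  apply/funext => n; elim: n => [|n IH]; last first.
    rewrite addSn seriesSr IH /stat_dist ifN -/p; last by rewrite -ltnNge; lia.
    have -> : (lam / mu0) ^+ K = (mu1 / mu0) ^+ K * (lam / mu1) ^+ K.
      by rewrite -exprMn; congr (_ ^+ _); field; rewrite m0 m1.
    rewrite exprD !exprS.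
    move: ((mu1 / mu0) ^+ K) ((lam / mu1) ^+ K) ((lam / mu1) ^+ n) => a b c.
    by field; rewrite m1 m1l.
  rewrite add0n expr0 mulr1 /series /=.
  transitivity (\sum_(0 <= k < K.+1) (lam / mu0) ^+ k * p).
    by apply: eq_big_nat => i /andP[_ iK]; rewrite /stat_dist -ltnS iK.
  rewrite -mulr_suml; set A := \sum_(0 <= k < K.+1) _.
  have : (A + lam / (mu1 - lam) * (lam / mu0) ^+ K) * p = 1.
    by rewrite -[X in X * _]invrK mulVf// pi0N.
  by move: ((lam / mu0) ^+ K) (lam / (mu1 - lam)) => a b <-; ring.
set C := p * _ * _.
have x0 : (lam / mu1) ^+ n @[n --> \oo] --> (0 : R).
  apply: cvg_expr; rewrite ger0_norm ?divr_ge0 ?ltW//.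
  by rewrite ltr_pdivrMr// mul1r.
have : (1 - C * (lam / mu1) ^+ n) @[n --> \oo] --> 1 - C * 0.
  by apply: cvgB; [exact: cvg_cst|apply: cvgM => //; exact: cvg_cst].
by rewrite mulr0 subr0.
Qed.

End StatDist.

(* Main.v *)
From HB Require Import structures.
Require Import Defs.
From mathcomp Require Import all_boot all_order all_algebra.
From mathcomp Require Import ring lra zify.
From mathcomp Require Import all_classical all_reals all_analysis.
From mathcomp Require Import measurable_realfun.
Set Implicit Arguments.
Unset Strict Implicit.
Unset Printing Implicit Defensive.
Import Order.TTheory GRing.Theory Num.Theory.
Import numFieldNormedType.Exports.
Local Open Scope classical_set_scope.
Local Open Scope ring_scope.

(** Let [F (n, m)] be the Laplace transform, at [s], of the sojourn time of a
    tagged customer at position [n] with [m] customers behind.  Conditioning on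
    the first jump gives
    [(lam + mu + s) F (n, m) = mu F (n - 1, m) + lam F (n, m + 1)], where [mu]
    is the service rate for [n + m] customers.  By PASTA the wanted transform is
    the mixture of the [F (n + 1, 0)] with the stationary weights.  The terms
    [n < K] are kept.  For [n >= K] the weights are proportional to [r ^+ n]
    with [r = lam / mu1], and the rate is [mu1] throughout the range
    [n > K], so that the sums [B k] of [r ^+ n * F (K + n + 1, k)] over [n]
    satisfy [(mu1 + s) B k = mu1 F (K, k) + lam B (k + 1)]: in the recursion for
    [F] the term [lam F (n, m)] on the left is cancelled by the shift of index
    ([column_sum_step]).  Unfolding this [K] times ([column_sum_expand])
    produces the second sum, up to a multiple of [B K].  With at least [K]
    customers behind the rate is [mu1] until the departure, hence
    [F (n, m) = (mu1 / (mu1 + s)) ^+ n] for [m >= K]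
    ([sojourn_laplace_geometric]); [B K] is then a geometric series
    ([column_sum_geometric]) and gives the last term.

    The first-step equation has to be extracted from the survival function of
    the jump chain and its holding times.  Along a fixed path the survival
    function determines the Laplace transform of the elapsed time, by converting
    one holding time after the other ([path_laplace]).  The event that the
    customer leaves at the [k]-th jump is a finite disjoint union of path events,
    whose contribution [sojourn_term s k] obeys a recursion in [k]
    ([hit_event_laplace]); summing over [k] turns it into the first-step equation
    ([sojourn_laplace_step]).  Two facts identify the sum with the transform of
    the sojourn time: on such an event the hitting time is the [k]-th jump time
    ([hitting_time_jump]), and these events exhaust the probability space
    ([sojourn_laplace_s0]), because the probability of leaving is the bounded
    solution of the first-step equation at [s = 0], and this solution is
    unique ([contraction_vanish]). *)

(** * Laplace transforms from exponential survival functions *)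

Section ExponentialLaw.
Local Open Scope ereal_scope.
Context (R : realType).
Notation leb := (@lebesgue_measure R).

Lemma measurable_expeR : measurable_fun [set: \bar R] (@expeR R).
Proof.
move=> _.
apply: (measurability _ (ErealGenOInfty.measurableE R)) => // _ [_ [r ->] <-].
rewrite setTI; have [r0|r0] := ltP r 0%R.
  rewrite (_ : _ @^-1` _ = setT)//; apply/seteqP; split => // x _ /=.
  by rewrite in_itv/= andbT (lt_le_trans _ (expeR_ge0 x))// lte_fin.
have [y yr] : exists y, expeR y = r%:E by exact: expeR_total.
rewrite (_ : _ @^-1` _ = [set` `]y, +oo[]); first exact: emeasurable_itv.
by apply/seteqP; split => x /=; rewrite !in_itv/= !andbT -yr lte_expeR.
Qed.

Lemma measurable_expeRN d (T : measurableType d) (s : R) (Z : T -> \bar R) :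
  measurable_fun [set: T] Z ->
  measurable_fun [set: T] (fun w => expeR (- (s%:E * Z w))).
Proof.
move=> mZ; apply: (measurableT_comp measurable_expeR).
by apply: measurableT_comp => //; exact: measurable_funeM.
Qed.

(** Reads [exp (- s z)] as the probability that an exponential clock of rate [s]
    outlives [z]; this is what lets Fubini trade a Laplace transform for a
    survival function.  It includes [z = +oo]. *)
Lemma exponential_cdf_laplace (s : R) (z : \bar R) : (0 < s)%R -> 0 < z ->
  \int[leb]_u (exponential_pdf s u * ((u : R)%:E < z)%E%:R)%:E
  + expeR (- (s%:E * z)) = 1.
Proof.
move=> s0; case: z => [z||//] z0; last first.
  rewrite gt0_muley ?lte_fin//= adde0 -(integral_exponential_pdf s0).
  by apply: eq_integral => u _; rewrite ltry mulr1.
rewrite lte_fin in z0.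
have mpdf D : measurable_fun D (fun u => (exponential_pdf s u)%:E).
  apply/measurable_EFinP; apply: measurable_funTS.
  exact: measurable_exponential_pdf.
have -> : \int[leb]_u (exponential_pdf s u * ((u : R)%:E < z%:E)%E%:R)%:E =
    \int[leb]_(u in `[0%R, z[) (exponential_pdf s u)%:E.
  rewrite [RHS]integral_mkcond; apply: eq_integral => u _.
  rewrite patchE; case: ifPn; rewrite ?inE /= ?notin_setE/= in_itv/= lte_fin.
    by case/andP => _ ->; rewrite mulr1.
  have [u0|u0] := leP 0%R u; last by rewrite lt0_exponential_pdf ?mul0r.
  by case: (u < z)%R => //= _; rewrite mulr0.
rewrite integral_itv_bndo_bndc//.
have := exponential_prob_itv0c s z0; rewrite /exponential_prob => ->.
by rewrite -EFinM -EFinN /= mulNr -EFinB -EFinD subrK.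
Qed.

(** Up to the factor [s / (s + q)], the integrand is the density of rate
    [s + q]. *)
Lemma exponential_pdf_laplace (s q c : R) :
  (0 < s)%R -> (0 < q)%R -> (0 <= c)%R ->
  \int[leb]_u ((exponential_pdf s u)%:E * (c * expR (- (q * u)))%:E) =
  (c * (s / (s + q)))%:E.
Proof.
move=> s0 q0 c0; have sq0 : (0 < s + q)%R by rewrite addr_gt0.
rewrite (_ : (c * (s / (s + q)))%:E = (c * (s / (s + q)))%:E *
    \int[leb]_u (exponential_pdf (s + q) u)%:E); last first.
  by rewrite (integral_exponential_pdf sq0) mule1.
rewrite -ge0_integralZl//=.
- suff E (u : R) : (exponential_pdf s u * (c * expR (- (q * u))) =
      c * (s / (s + q)) * exponential_pdf (s + q) u)%R.
    by apply: eq_integral => u _; rewrite -!EFinM E.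
  have [u0|u0] := leP 0%R u; last by rewrite !lt0_exponential_pdf ?mul0r ?mulr0.
  rewrite !exponential_pdfE//.
  rewrite (_ : - (s + q) * u = - s * u + - (q * u))%R; last by ring.
  by rewrite expRD; field; rewrite gt_eqF.
- by apply/measurable_EFinP; exact: measurable_exponential_pdf.
- by move=> u _; rewrite lee_fin exponential_pdf_ge0// ltW.
- by rewrite lee_fin mulr_ge0// divr_ge0 ?ltW.
Qed.

(** The hypothesis says that, under the measure with density [W] on [A], the
    variable [Z] is [c] times an exponential law of rate [q], so the conclusion
    is the Laplace transform of that law.  For [s > 0] integrate
    [W w * pdf_s u] over the region [u < Z w] in both orders: integrating [u]
    first gives [W (1 - exp (- s Z))], integrating [w] first gives the survival
    function.  The weight [W] is what makes the lemma usable one coordinate at a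
    time for a vector of holding times. *)
Lemma laplace_exponential_survival d (T : measurableType d)
   (P : {finite_measure set T -> \bar R})
   (A : set T) (W Z : T -> \bar R) (c q s : R) :
  measurable A -> measurable_fun [set: T] W -> (forall w, 0 <= W w) ->
  measurable_fun [set: T] Z -> (forall w, A w -> 0 < Z w) ->
  (0 < q)%R -> (0 <= s)%R ->
  (forall u : R, (0 <= u)%R ->
     \int[P]_(w in A `&` [set w | u%:E < Z w]) W w = (c * expR (- (q * u)))%:E) ->
  \int[P]_(w in A) (W w * expeR (- (s%:E * Z w))) = (c * (q / (q + s)))%:E.
Proof.
move=> mA mW W0 mZ Z0 q0; rewrite le_eqVlt => /predU1P[<-|s0] tail.
all: have intA : \int[P]_(w in A) W w = c%:E.
1,3: have := tail 0%R (lexx _); rewrite mulr0 oppr0 expR0 mulr1 => <-;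
   by congr (integral _ _ _); apply/esym/setIidPl => w /Z0.
  rewrite addr0 divff ?gt_eqF// mulr1 -intA; apply: eq_integral => w _.
  by rewrite mul0e oppe0 expeR0 mule1.
have c0 : (0 <= c)%R by rewrite -lee_fin -intA; exact: integral_ge0.
pose g (p : T * measurableTypeR R) : \bar R :=
   (exponential_pdf s p.2 * ((p.2 : R)%:E < Z p.1)%E%:R)%:E.
pose f (p : T * measurableTypeR R) : \bar R := (W p.1 * (\1_A p.1)%:E) * g p.
have pdf0 u : 0 <= (exponential_pdf s u)%:E.
  by rewrite lee_fin exponential_pdf_ge0// ltW.
have mpdf : measurable_fun setT (fun u => (exponential_pdf s u)%:E).
  by apply/measurable_EFinP; exact: measurable_exponential_pdf.
have g0 p : 0 <= g p by rewrite lee_fin mulr_ge0// -lee_fin.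
have mg : measurable_fun setT g.
  rewrite /g; under eq_fun do rewrite EFinM; apply: emeasurable_funM.
    exact: (measurableT_comp mpdf).
  apply/measurable_EFinP.
  rewrite (_ : (fun x : T * measurableTypeR R => _) =
      \1_[set p : T * measurableTypeR R | (p.2 : R)%:E < Z p.1]).
    apply: measurable_indic; rewrite -[X in measurable X]setTI.
    by apply: measurable_lte => //; exact: measurableT_comp.
  by apply/funext => p; rewrite indicE mem_setE.
have mf : measurable_fun setT f.
  apply: emeasurable_funM => //; apply: emeasurable_funM.
  - exact: measurableT_comp.
  - by apply/measurable_EFinP; apply: measurableT_comp.
have f0 p : 0 <= f p by rewrite !mule_ge0// lee_fin// indicE.
have := fubini_tonelli (m1 := P) (m2 := leb) f mf f0.
have -> : \int[leb]_y \int[P]_x f (x, y) =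
    (c * (s / (s + q)))%:E.
  rewrite -exponential_pdf_laplace//; apply: eq_integral => u _.
  have [u0|u0] := leP 0%R u; last first.
    rewrite lt0_exponential_pdf// mul0e; apply: integral0_eq => w _.
    by rewrite /f/g/= lt0_exponential_pdf// mul0r mule0.
  rewrite -tail// -ge0_integralZl//.
  - rewrite [RHS]integral_mkcond; apply: eq_integral => w _.
    rewrite /f/g/= patchE indicE in_setI.
    rewrite (_ : (w \in [set w | u%:E < Z w]) = (u%:E < Z w)) ?mem_setE//.
    by case: (w \in A); case: (u%:E < Z w);
      rewrite /= ?(mulr0, mulr1, mule0, mul0e, mule1)// muleC.
  - apply: measurableI => //; rewrite -[X in measurable X]setTI.
    by apply: measurable_lte.
  - exact: measurable_funTS.
have -> : \int[P]_x \int[leb]_y f (x, y) =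
   \int[P]_(w in A) (W w * \int[leb]_u g (w, u)).
  rewrite [RHS]integral_mkcond; apply: eq_integral => w _.
  rewrite patchE; case: ifPn => wA; last first.
    by apply: integral0_eq => u _; rewrite /f/= indicE (negbTE wA) mule0 mul0e.
  rewrite -ge0_integralZl//.
  - by apply: eq_integral => u _; rewrite /f/= indicE wA mule1.
  - exact: measurableT_comp mg _.
move=> fub.
have mE := measurable_expeRN s mZ.
have mI : measurable_fun setT (fun w => \int[leb]_u g (w, u)).
  exact: (measurable_fun_fubini_tonelli_F (m2 := leb) g mg g0).
have I0 w : 0 <= \int[leb]_u g (w, u) by exact: integral_ge0.
have : \int[P]_(w in A) (W w * \int[leb]_u g (w, u))
   + \int[P]_(w in A) (W w * expeR (- (s%:E * Z w))) = c%:E.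
  rewrite -intA -ge0_integralD//.
  - apply: eq_integral => w; rewrite inE => /Z0 w0.
    rewrite -ge0_muleDr ?expeR_ge0//.
    by have /= -> := exponential_cdf_laplace s0 w0; rewrite mule1.
  - by move=> w _; rewrite mule_ge0.
  - apply: measurable_funTS; exact: emeasurable_funM.
  - by move=> w _; rewrite mule_ge0// expeR_ge0.
  - apply: measurable_funTS; exact: emeasurable_funM.
rewrite fub; move: (\int[_]_(_ in _) _) => [r||]//=.
rewrite -EFinD => -[] rE; congr EFin.
have -> : (r = c - c * (s / (s + q)))%R.
  by rewrite -[X in (_ = X - _)%R]rE addrC addKr.
by field; rewrite !gt_eqF// addr_gt0.
Qed.
End ExponentialLaw.

(** * Holding times along a prescribed path of a Markov chain *)

Section PathLaw.
Local Open Scope ereal_scope.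
Context (R : realType) (E : countType) (d : measure_display)
  (Omega : measurableType d) (P : probability Omega R).
Context (nu : E -> R) (Q : E -> E -> R) (Y : nat -> Omega -> E)
  (T : nat -> Omega -> \bar R).
Hypothesis law : jump_holding_law P nu Q Y T.

Definition path_event (k : nat) (y : nat -> E) (t : nat -> R) : set Omega :=
  [set w | forall i, (i <= k)%N -> Y i w = y i /\ (t i)%:E < T i w].

Lemma measurable_path_event k y t : measurable (path_event k y t).
Proof.
have [mY mT _] := law.
rewrite (_ : path_event k y t = \bigcap_(i in [set i | (i <= k)%N])
   ([set w | Y i w = y i] `&` ([set: Omega] `&` [set w | (t i)%:E < T i w]))).
  apply: bigcap_measurable; first by exists 0%N.
  by move=> i _; apply: measurableI => //; exact: measurable_lte.
apply/seteqP; split => w wk i ik; first by have [? ?] := wk i ik.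
by have [? []] := wk i ik.
Qed.

Lemma measurable_jump_time k : measurable_fun [set: Omega] (jump_time T k).
Proof. by have [_ mT _] := law; exact: emeasurable_sum. Qed.

Lemma jump_time_ge0 k w :
  (forall i, (i < k)%N -> 0 < T i w) -> 0 <= jump_time T k w.
Proof. by move=> T0; apply: sume_ge0 => i _; exact/ltW/T0. Qed.

Lemma jump_timeS k w : jump_time T k.+1 w = jump_time T k w + T k w.
Proof. by rewrite /jump_time big_ord_recr. Qed.

(** The case [j = 0] is the definition of the law of the chain.  The induction
    on [j] converts the holding times from survival functions to Laplace
    transforms one at a time: letting the threshold [t j] run over the positive
    reals exhibits [T j] as exponential under the measure weighted by the
    factors already converted. *)
Lemma path_laplace (s : R) (j k : nat) (y : nat -> E) (t : nat -> R) :
  (0 <= s)%R -> (j <= k)%N ->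
  (forall i, (i < j)%N -> (0 < exit_rate Q (y i))%R) ->
  (forall i, (0 <= t i)%R) -> (forall i, (i < j)%N -> t i = 0%R) ->
  \int[P]_(w in path_event k y t) expeR (- (s%:E * jump_time T j w)) =
  (nu (y 0%N) * (\prod_(i < k) jump_prob Q (y i) (y i.+1))
   * (\prod_(i < j) (exit_rate Q (y i) / (exit_rate Q (y i) + s)))
   * \prod_(j <= i < k.+1) expR (- (exit_rate Q (y i) * t i)))%:E.
Proof.
move=> s0; have [mY mT lawE] := law.
elim: j t => [|j IH] t jk q0 t0 tj.
  rewrite big_ord0 mulr1 big_mkord -lawE//.
  under eq_integral do rewrite /jump_time big_ord0 mule0 oppe0 expeR0.
  by rewrite integral_cst ?mul1e//; exact: measurable_path_event.
rewrite [RHS](_ : _ = (nu (y 0%N) * (\prod_(i < k) jump_prob Q (y i) (y i.+1))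
   * (\prod_(i < j) (exit_rate Q (y i) / (exit_rate Q (y i) + s)))
   * (\prod_(j.+1 <= i < k.+1) expR (- (exit_rate Q (y i) * t i)))
   * (exit_rate Q (y j) / (exit_rate Q (y j) + s)))%:E); last first.
  by rewrite big_ord_recr/= [in LHS]mulrA [in LHS]mulrAC.
have Tgt0 w : path_event k y t w -> forall i, (i <= k)%N -> 0 < T i w.
  by move=> wA i /wA[_]; apply: le_lt_trans; rewrite lee_fin.
rewrite -(laplace_exponential_survival (P := P) (A := path_event k y t)
   (W := fun w => expeR (- (s%:E * jump_time T j w))) (Z := T j)) //.
- apply: eq_integral => w; rewrite inE => /Tgt0 wT.
  have j0 : 0 <= jump_time T j w by apply: jump_time_ge0 => i ij; apply: wT; lia.
  have Tj0 : 0 <= T j w by apply/ltW/wT; lia.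
  rewrite jump_timeS ge0_muleDr// oppeD ?expeRD//.
  by apply: ge0_adde_def; rewrite inE mule_ge0.
- exact: measurable_path_event.
- by apply: measurable_expeRN; exact: measurable_jump_time.
- by move=> w; exact: expeR_ge0.
- by move=> w /Tgt0; apply; lia.
- exact: q0.
- move=> u u0; pose t' i := if i == j then u else t i.
  rewrite (_ : _ `&` _ = path_event k y t').
    rewrite IH.
    + rewrite (big_ltn (m := j))//; last by lia.
      rewrite /t' eqxx [in RHS]mulrAC mulrA; congr (_ * _)%:E.
      apply: eq_big_nat => i /andP[ji _].
      by rewrite ifN//; apply/eqP; lia.
    + lia.
    + by move=> i ij; apply: q0; lia.
    + by move=> i; rewrite /t'; case: ifP.
    + by move=> i ij; rewrite /t' ifN ?tj//; [lia|apply/eqP; lia].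
  apply/seteqP; split => w /=.
    move=> [wA wu] i ik; have [? ?] := wA i ik; split => //.
    by rewrite /t'; case: eqP => // ->.
  move=> wA; split; last by have := wA j (ltnW jk); rewrite /t' eqxx => -[].
  move=> i ik; have [? Ti] := wA i ik; split => //; move: Ti; rewrite /t'.
  by case: eqP => // ->; apply: le_lt_trans; rewrite tj// lee_fin.
Qed.
End PathLaw.

(** * Hitting times of step paths *)

(** Positivity of the holding times up to [N] makes [0 <= jump_time T N], which
    puts that time in the range of the infimum, and gives the [N]-th state a
    nonempty time interval on which the path is [Y N].  If an earlier holding
    time is infinite both sides are [+oo]. *)
Lemma hitting_time_jump (R : realType) (E : countType) (d : measure_display)
    (Omega : measurableType d) (X : R -> Omega -> E) (A : set E)
    (Y : nat -> Omega -> E) (T : nat -> Omega -> \bar R) (N : nat) (w : Omega) :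
  (forall (k : nat) (t : R), (jump_time T k w <= t%:E)%E ->
     (t%:E < jump_time T k.+1 w)%E -> X t w = Y k w) ->
  (forall i, (i <= N)%N -> (0 < T i w)%E) ->
  (forall i, (i < N)%N -> ~ A (Y i w)) -> A (Y N w) ->
  hitting_time X A w = jump_time T N w.
Proof.
move=> XY T0 nA AN; apply/eqP; rewrite eq_le; apply/andP; split.
  have [N0|->] : (0 <= jump_time T N w < +oo)%E \/ jump_time T N w = +oo%E.
  - have N0 : (0 <= jump_time T N w)%E.
      by apply: jump_time_ge0 => i iN; apply: T0; exact: ltnW.
    move: N0; case: (jump_time T N w) => [r||]// ->; last by right.
    by left; rewrite ltry.
  - move: N0; case tN : (jump_time T N w) => [r||]//;
      rewrite ?ltxx ?andbF// => /andP[r0 _].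
    apply: ereal_inf_lbound; exists r => //; split => //.
    rewrite (XY N)// ?tN// jump_timeS tN.
    move: (T0 N (leqnn N)); case: (T N w) => [u||]// u0.
      by rewrite -EFinD lte_fin ltrDl -lte_fin.
    by rewrite addey// ltry.
  - by rewrite leey.
apply: le_ereal_inf_tmp => _ [t [t0 At] <-]; rewrite leNgt; apply/negP => tN.
have ex : exists k, (t%:E < jump_time T k w)%E by exists N.
case: (ex_minnP ex) => -[|k]; first by rewrite /jump_time big_ord0 lte_fin ltNge t0.
move=> tk kmin; apply: (nA k); first by exact: (kmin _ tN).
by rewrite -(XY k t)// leNgt; apply/negP => /kmin; rewrite ltnn.
Qed.

(** * The tagged customer: expansion over the number of jumps *)

Section TaggedCustomer.
Context (R : realType) (lam mu0 mu1 : R) (K : nat).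
Hypotheses (lam0 : 0 < lam) (mu0_gt0 : 0 < mu0) (mu1_gt0 : 0 < mu1).
Local Notation rate := (service_rate mu0 mu1 K).
Local Notation Q := (tagged_gen lam mu0 mu1 K).

Lemma service_rate_gt0 j : 0 < rate j.
Proof. by rewrite /service_rate; case: ifP. Qed.

Definition departure (x : nat * nat) := (x.1.-1, x.2).
Definition arrival (x : nat * nat) := (x.1, x.2.+1).

Lemma exit_rate_tagged x : x.1 != 0%N ->
  exit_rate Q x = lam + rate (x.1 + x.2).
Proof.
case: x => [[|n] m]//= _.
rewrite /exit_rate /tagged_gen ifN; last by apply/eqP => -[]; lia.
by rewrite ifN ?eqxx ?opprK//; apply/eqP => -[]; lia.
Qed.

Lemma exit_rate_gt0 x : x.1 != 0%N -> 0 < exit_rate Q x.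
Proof. by move=> x0; rewrite exit_rate_tagged// addr_gt0// service_rate_gt0. Qed.

Lemma jump_departure x : x.1 != 0%N ->
  jump_prob Q x (departure x) = rate (x.1 + x.2) / exit_rate Q x.
Proof.
move=> x0; rewrite /jump_prob gt_eqF ?exit_rate_gt0//.
case: x x0 => [[|n] m]//= _; rewrite ifN; last by apply/eqP => -[]; lia.
by rewrite eqxx.
Qed.

Lemma jump_arrival x : x.1 != 0%N ->
  jump_prob Q x (arrival x) = lam / exit_rate Q x.
Proof.
move=> x0; rewrite /jump_prob gt_eqF ?exit_rate_gt0//.
case: x x0 => [[|n] m]//= _; rewrite ifN; last by apply/eqP => -[]; lia.
by rewrite ifN ?eqxx//; apply/eqP => -[]; lia.
Qed.

(** The expectation of [exp (- s S)] over the event that the tagged customer,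
    started in [x], leaves at exactly the [k]-th jump. *)
Fixpoint sojourn_term (s : R) (k : nat) (x : nat * nat) : R :=
  let q := lam + rate (x.1 + x.2) + s in
  if x.1 == 0%N then (k == 0%N)%:R
  else if k is k'.+1 then
    rate (x.1 + x.2) / q * sojourn_term s k' (departure x)
    + lam / q * sojourn_term s k' (arrival x)
  else 0.

Lemma sojourn_term_ge0 s k x : 0 <= s -> 0 <= sojourn_term s k x.
Proof.
move=> s0; elim: k x => [|k IH] x /=; case: ifP => // _.
have r0 := service_rate_gt0 (x.1 + x.2).
have q0 : 0 < lam + rate (x.1 + x.2) + s by rewrite ltr_wpDr ?addr_gt0.
by apply: addr_ge0; apply: mulr_ge0 => //; apply: divr_ge0; apply: ltW.
Qed.

Section FirstHit.
Local Open Scope ereal_scope.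
Context (d : measure_display) (Omega : measurableType d)
  (P : probability Omega R).
Context (nu : nat * nat -> R) (Y : nat -> Omega -> nat * nat)
  (T : nat -> Omega -> \bar R).
Hypothesis law : jump_holding_law P nu Q Y T.

Definition extend (y : nat -> nat * nat) (j : nat) (x : nat * nat) (i : nat) :=
  if i == j then x else y i.

(** The event that [Y] follows [y] up to step [j] and then departures and
    arrivals only, that the tagged customer leaves at step [j + l], and that all
    holding times up to that step are positive.  Building it as a finite tree of
    path events gives its probability without having to know beforehand that
    other jumps or null holding times have probability zero. *)
Fixpoint hit_event (l j : nat) (y : nat -> nat * nat) : set Omega :=
  if l is l'.+1 then
    if (y j).1 == 0%N then set0
    else hit_event l' j.+1 (extend y j.+1 (departure (y j)))
         `|` hit_event l' j.+1 (extend y j.+1 (arrival (y j)))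
  else if (y j).1 == 0%N then path_event Y T j y (fun=> 0%R) else set0.

Lemma measurable_hit_event l j y : measurable (hit_event l j y).
Proof.
elim: l j y => [|l IH] j y /=; case: ifP => // _.
  exact: (measurable_path_event law).
exact: measurableU.
Qed.

Lemma hit_eventP l j y w : hit_event l j y w ->
  [/\ forall i, (i <= j)%N -> Y i w = y i,
      forall i, (i <= j + l)%N -> 0 < T i w,
      forall i, (j <= i < j + l)%N -> (Y i w).1 != 0%N &
      (Y (j + l) w).1 = 0%N].
Proof.
elim: l j y => [|l IH] j y /=.
  case: eqP => // yj yw; rewrite addn0; split.
  - by move=> i /yw[].
  - by move=> i /yw[].
  - by move=> i; lia.
  - by have [->] := yw j (leqnn j).
have step x : (y j).1 != 0%N -> hit_event l j.+1 (extend y j.+1 x) w ->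
  [/\ forall i, (i <= j)%N -> Y i w = y i,
      forall i, (i <= j + l.+1)%N -> 0 < T i w,
      forall i, (j <= i < j + l.+1)%N -> (Y i w).1 != 0%N &
      (Y (j + l.+1) w).1 = 0%N].
  move=> yj0 /IH[Yy T0 Y0 YN]; have Yj i : (i <= j)%N -> Y i w = y i.
    by move=> ij; rewrite Yy /extend ?ifN//; [apply/eqP; lia|lia].
  split => //.
  - by move=> i ij; apply: T0; lia.
  - move=> i ij; have [->|ji] := eqVneq i j; first by rewrite Yj.
    by apply: Y0; lia.
  - by rewrite addnS -addSn.
by case: eqVneq => // yj0 [|] /(step _ yj0).
Qed.

Lemma hit_event_laplace (s : R) l j y : (0 <= s)%R ->
  (forall i, (i < j)%N -> (y i).1 != 0%N) ->
  \int[P]_(w in hit_event l j y) expeR (- (s%:E * jump_time T (j + l) w)) =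
  (nu (y 0%N) * (\prod_(i < j) jump_prob Q (y i) (y i.+1))
   * (\prod_(i < j) (exit_rate Q (y i) / (exit_rate Q (y i) + s)))
   * sojourn_term s l (y j))%:E.
Proof.
move=> s0; elim: l j y => [|l IH] j y y0 /=.
  case: ifP => _; last by rewrite integral_set0 mulr0.
  rewrite addn0 (path_laplace law)// => [|i /y0 /exit_rate_gt0//].
  by rewrite big_nat1 mulr0 oppr0 expR0.
case: ifPn => yj; first by rewrite integral_set0 mulr0.
have me z : measurable_fun setT (fun w => expeR (- (s%:E * jump_time T z w))).
  exact/measurable_expeRN/(measurable_jump_time law).
rewrite ge0_integral_setU//; first last.
- rewrite disj_set2E; apply/eqP; rewrite -subset0 => w [].
  move=> /hit_eventP[/(_ j.+1 (leqnn _)) Yd _ _ _].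
  move=> /hit_eventP[/(_ j.+1 (leqnn _)) + _ _ _].
  by rewrite Yd /extend eqxx /departure /arrival => -[]; lia.
- by move=> w _; exact: expeR_ge0.
- exact: measurable_funTS.
- exact: measurable_hit_event.
- exact: measurable_hit_event.
have step x : \int[P]_(w in hit_event l j.+1 (extend y j.+1 x))
      expeR (- (s%:E * jump_time T (j + l.+1) w)) =
  (nu (y 0%N) * (\prod_(i < j) jump_prob Q (y i) (y i.+1))
   * (\prod_(i < j) (exit_rate Q (y i) / (exit_rate Q (y i) + s)))
   * (jump_prob Q (y j) x * (exit_rate Q (y j) / (exit_rate Q (y j) + s))
      * sojourn_term s l x))%:E.
  have ey i : (i <= j)%N -> extend y j.+1 x i = y i.
    by move=> ij; rewrite /extend ifN//; apply/eqP; lia.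
  have ex : extend y j.+1 x j.+1 = x by rewrite /extend eqxx.
  rewrite addnS -addSn IH; last first.
    move=> i; rewrite ltnS => ij; rewrite ey//.
    by case: (ltngtP i j) ij => // [/y0|->].
  rewrite !big_ord_recr/= !(ey j)// ex (ey 0%N)//.
  rewrite (eq_bigr (fun i : 'I_j => jump_prob Q (y i) (y i.+1))); last first.
    by move=> i _; rewrite !ey// ltnW.
  rewrite [X in (_ * (X * _) * _)%R](eq_bigr
      (fun i : 'I_j => exit_rate Q (y i) / (exit_rate Q (y i) + s)))%R; last first.
    by move=> i _; rewrite !ey// ltnW.
  by rewrite -[in LHS]mulrA; congr EFin; ring.
rewrite !step -EFinD jump_departure// jump_arrival// -mulrDr; congr (_ * _)%:E.
have q0 := exit_rate_gt0 yj.
rewrite -exit_rate_tagged//; congr (_ * _ + _ * _)%R.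
  by field; rewrite !gt_eqF// ltr_wpDr.
by field; rewrite !gt_eqF// ltr_wpDr.
Qed.

End FirstHit.

Section TotalMass.
Local Open Scope ereal_scope.
Context (d : measure_display) (Omega : measurableType d)
  (P : probability Omega R).
Context (x : nat * nat) (Y : nat -> Omega -> nat * nat)
  (T : nat -> Omega -> \bar R).
Hypothesis law : jump_holding_law P (point_mass R x) Q Y T.

Let first_hit (k : nat) : set Omega := hit_event Y T k 0 (fun=> x).

Let measurable_first_hit k : measurable (first_hit k).
Proof. exact: (measurable_hit_event law). Qed.

Let trivIset_first_hit : trivIset setT first_hit.
Proof.
apply: ltn_trivIset => m n nm; rewrite -subset0 => w [].
move=> /hit_eventP[_ _ _]; rewrite add0n => Yn /hit_eventP[_ _ /(_ n) + _].
by rewrite !add0n Yn => /(_ nm).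
Qed.

Let first_hit_laplace (s : R) k : (0 <= s)%R ->
  \int[P]_(w in first_hit k) expeR (- (s%:E * jump_time T k w)) =
  (sojourn_term s k x)%:E.
Proof.
move=> s0; have /= := hit_event_laplace law k (j := 0%N) (y := fun=> x) s0.
by rewrite add0n => -> //; rewrite !big_ord0 /point_mass eqxx !mul1r.
Qed.

Lemma hitting_massE :
  \sum_(k <oo) (sojourn_term 0 k x)%:E = P (\bigcup_k first_hit k).
Proof.
rewrite measure_bigcup//= [RHS](eq_eseriesl (Q := xpredT)) => [|k]; last first.
  exact: in_setT.
apply: eq_eseriesr => k _.
rewrite -first_hit_laplace//; under eq_integral do rewrite mul0e oppe0 expeR0.
by rewrite integral_cst// mul1e.
Qed.

Lemma hitting_mass_le1 : \sum_(k <oo) (sojourn_term 0 k x)%:E <= 1.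
Proof.
by rewrite hitting_massE; apply: probability_le1; exact: bigcup_measurable.
Qed.

(** When the first-hit events have total mass 1 they carry the whole
    integral, and on each of them the sojourn time is a jump time.  Leaving
    after finitely many jumps is also what keeps the values of [X] after an
    explosion out of the hitting time. *)
Lemma laplace_hitting_time (X : R -> Omega -> nat * nat)
    (S : {RV P >-> \bar R}) (s : R) :
  (0 <= s)%R -> \sum_(k <oo) (sojourn_term 0 k x)%:E = 1 ->
  {ae P, forall w, forall (k : nat) (t : R),
      jump_time T k w <= t%:E -> t%:E < jump_time T k.+1 w -> X t w = Y k w} ->
  {ae P, forall w, S w = hitting_time X [set x | x.1 = 0%N] w} ->
  laplace S s = \sum_(k <oo) (sojourn_term s k x)%:E.
Proof.
move=> s0 mass XY SX.
set D := \bigcup_k first_hit k.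
have mD : measurable D by exact: bigcup_measurable.
have PD : P (~` D) = 0 by rewrite probability_setC// -hitting_massE mass subee.
have mS : measurable_fun setT S by [].
have mE : measurable_fun setT (fun w => expeR (- (s%:E * S w))).
  exact: measurable_expeRN.
rewrite /laplace -(setUv D) ge0_integral_setU//; first last.
- by rewrite disj_set2E setICr.
- by move=> w _; exact: expeR_ge0.
- by rewrite setUv.
- exact: measurableC.
rewrite [X in _ + X](_ : _ = 0) ?adde0; last first.
  by apply: null_set_integral => //; [exact: measurableC|exact: measurable_funTS].
rewrite ge0_integral_bigcup//; last 2 first.
- exact: measurable_funTS.
- by move=> w _; exact: expeR_ge0.
apply: eq_eseriesr => k _; rewrite -first_hit_laplace//.
apply: ae_eq_integral => //.
- exact: measurable_funTS.
- exact/measurable_funTS/measurable_expeRN/(measurable_jump_time law).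
apply: filterS2 XY SX => w Xw Sw /hit_eventP[_ T0 Y0 YN].
by rewrite Sw (hitting_time_jump Xw T0)// => i ik; exact/eqP/Y0.
Qed.

End TotalMass.

(** * First-step analysis *)

(** The uniqueness principle behind both evaluations below: a bounded solution
    of the linear recursion in the number of customers behind is determined,
    because the difference of two solutions at [m] is dominated by [rho ^+ k]
    times the difference at [m + k]. *)
Lemma contraction_vanish (v : nat -> R) (rho C : R) : 0 <= rho < 1 ->
  (forall m, `|v m| <= rho * `|v m.+1|) -> (forall m, `|v m| <= C) ->
  forall m, v m = 0.
Proof.
move=> /andP[rho0 rho1] vS vC m; apply/eqP; rewrite -normr_le0.
have bound k : `|v m| <= C * rho ^+ k.
  suff : `|v m| <= rho ^+ k * `|v (m + k)%N|.
    by move=> /le_trans; apply; rewrite mulrC ler_wpM2r// exprn_ge0.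
  elim: k => [|k IH]; first by rewrite addn0 mul1r.
  by apply: (le_trans IH); rewrite addnS exprSr -mulrA ler_wpM2l// exprn_ge0.
have cv : C * rho ^+ k @[k --> \oo] --> C * 0.
  by apply: cvgMl_tmp; apply: cvg_expr; rewrite ger0_norm.
rewrite -[leRHS](mulr0 C) -(cvg_lim _ cv)//; apply: limr_ge.
  by apply/cvg_ex; exists (C * 0).
exact: nearW.
Qed.

Section FirstStep.
Hypothesis mass_le1 : forall x, (\sum_(k <oo) (sojourn_term 0 k x)%:E <= 1)%E.

Definition sojourn_laplace (s : R) (x : nat * nat) : R :=
  fine (\sum_(k <oo) (sojourn_term s k x)%:E)%E.

Lemma sojourn_term_antitone s k x : 0 <= s ->
  sojourn_term s k x <= sojourn_term 0 k x.
Proof.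
move=> s0; elim: k x => [|k IH] x /=; case: ifP => // _.
have r0 := service_rate_gt0 (x.1 + x.2).
have q0 : 0 < lam + rate (x.1 + x.2) by rewrite addr_gt0.
have qs0 : 0 < lam + rate (x.1 + x.2) + s by rewrite ltr_wpDr.
have inv_le : (lam + rate (x.1 + x.2) + s)^-1 <= (lam + rate (x.1 + x.2))^-1.
  by rewrite lef_pV2 ?posrE// lerDl.
rewrite addr0; apply: lerD; apply: ler_pM; rewrite ?IH ?sojourn_term_ge0//.
- by apply: divr_ge0; apply: ltW.
- by rewrite ler_wpM2l// ltW.
- by apply: divr_ge0; apply: ltW.
- by rewrite ler_wpM2l// ltW.
Qed.

Lemma sojourn_laplaceE s x : 0 <= s ->
  (\sum_(k <oo) (sojourn_term s k x)%:E)%E = (sojourn_laplace s x)%:E.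
Proof.
move=> s0; rewrite /sojourn_laplace fineK// ge0_fin_numE; last first.
  by apply: nneseries_ge0 => k _ _; rewrite lee_fin sojourn_term_ge0.
apply: le_lt_trans (ltry 1); apply: le_trans (mass_le1 x).
apply: lee_nneseries => k _; first by rewrite lee_fin sojourn_term_ge0.
by rewrite lee_fin sojourn_term_antitone.
Qed.

Lemma sojourn_laplace_ge0 s x : 0 <= s -> 0 <= sojourn_laplace s x.
Proof.
move=> s0; rewrite -lee_fin -sojourn_laplaceE//.
by apply: nneseries_ge0 => k _ _; rewrite lee_fin sojourn_term_ge0.
Qed.

Lemma sojourn_laplace_le1 s x : 0 <= s -> sojourn_laplace s x <= 1.
Proof.
move=> s0; rewrite -lee_fin -sojourn_laplaceE//; apply: le_trans (mass_le1 x).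
apply: lee_nneseries => k _; first by rewrite lee_fin sojourn_term_ge0.
by rewrite lee_fin sojourn_term_antitone.
Qed.

Lemma sojourn_laplace_absorbed s m : 0 <= s -> sojourn_laplace s (0%N, m) = 1.
Proof.
move=> s0; apply: EFin_inj; rewrite -sojourn_laplaceE//.
rewrite nneseries_recl// => [|k _]; last by rewrite lee_fin sojourn_term_ge0.
rewrite /= eseries0 ?adde0// => -[|k]//= _ _.
Qed.

Lemma sojourn_laplace_step s n m : 0 <= s ->
  (lam + rate (n.+1 + m) + s) * sojourn_laplace s (n.+1, m) =
  rate (n.+1 + m) * sojourn_laplace s (n, m)
  + lam * sojourn_laplace s (n.+1, m.+1).
Proof.
move=> s0; have r0 := service_rate_gt0 (n.+1 + m).
set q := lam + rate (n.+1 + m) + s.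
have q0 : 0 < q by rewrite ltr_wpDr ?addr_gt0.
have t0 k x : (0 <= (sojourn_term s k x)%:E)%E by rewrite lee_fin sojourn_term_ge0.
suff -> : sojourn_laplace s (n.+1, m) =
    rate (n.+1 + m) / q * sojourn_laplace s (n, m)
    + lam / q * sojourn_laplace s (n.+1, m.+1).
  by field; rewrite gt_eqF.
apply: EFin_inj; rewrite EFinD !EFinM -!sojourn_laplaceE//.
rewrite -!nneseriesZl// -nneseriesD//; first last.
- by move=> k _ _; rewrite mule_ge0// lee_fin divr_ge0 ?ltW.
- by move=> k _ _; rewrite mule_ge0// lee_fin divr_ge0 ?ltW.
rewrite nneseries_recl//= add0e -(nneseries_addn 1)//.
by apply: eq_eseriesr => k _; rewrite addn1 -!EFinM -EFinD.
Qed.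

(** The tagged customer leaves almost surely: the probability of never leaving
    satisfies the first-step recursion, whose coefficient on the arrival side is
    at most [lam / (lam + min mu0 mu1) < 1]. *)
Lemma sojourn_laplace_s0 x : sojourn_laplace 0 x = 1.
Proof.
case: x => n m; elim: n m => [|n IH] m; first exact: sojourn_laplace_absorbed.
suff /(_ m)/eqP : forall m, 1 - sojourn_laplace 0 (n.+1, m) = 0.
  by rewrite subr_eq0 => /eqP.
have mu_min : 0 < Num.min mu0 mu1 by rewrite lt_min mu0_gt0.
apply: (contraction_vanish (rho := lam / (lam + Num.min mu0 mu1)) (C := 1)).
- rewrite divr_ge0 ?addr_ge0 ?(ltW lam0) ?(ltW mu_min)//=.
  by rewrite ltr_pdivrMr ?addr_gt0// mul1r ltrDl.
- move=> {}m; have r0 := service_rate_gt0 (n.+1 + m).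
  have := sojourn_laplace_step n m (lexx 0); rewrite addr0 IH mulr1 => rec.
  have -> : 1 - sojourn_laplace 0 (n.+1, m) =
      lam / (lam + rate (n.+1 + m)) * (1 - sojourn_laplace 0 (n.+1, m.+1)).
    have q0 : lam + rate (n.+1 + m) != 0 by rewrite gt_eqF ?addr_gt0.
    apply: (mulfI q0); rewrite mulrBr rec mulr1.
    by field.
  have lr0 : 0 <= lam / (lam + rate (n.+1 + m)).
    by apply: divr_ge0; apply: ltW => //; rewrite addr_gt0.
  rewrite normrM ler_wpM2r// ger0_norm// ler_wpM2l ?(ltW lam0)//.
  rewrite lef_pV2 ?posrE ?addr_gt0// lerD2l.
  by rewrite /service_rate; case: ifP => _; rewrite ge_min lexx ?orbT.
- move=> {}m; have := sojourn_laplace_ge0 (n.+1, m) (lexx 0).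
  have := sojourn_laplace_le1 (n.+1, m) (lexx 0).
  by rewrite ler_norml; lra.
Qed.

(** With at least [K] customers behind, the server works at rate [mu1] until the
    tagged customer leaves, so his sojourn is a sum of [n] independent
    exponentials.  Here this is seen by checking that the power solves the
    first-step recursion. *)
Lemma sojourn_laplace_geometric s n m : 0 <= s -> (K <= m)%N ->
  sojourn_laplace s (n, m) = (mu1 / (mu1 + s)) ^+ n.
Proof.
move=> s0; elim: n m => [|n IH] m Km; first exact: sojourn_laplace_absorbed.
set b := mu1 / (mu1 + s).
have sum0 : 0 < mu1 + s by rewrite ltr_wpDr.
have b0 : 0 <= b by rewrite divr_ge0 ?ltW.
suff /(_ (m - K)%N)/eqP : forall j,
    sojourn_laplace s (n.+1, (K + j)%N) - b ^+ n.+1 = 0.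
  by rewrite subr_eq0 subnKC// => /eqP.
apply: (contraction_vanish (rho := lam / (lam + mu1)) (C := 1)).
- rewrite divr_ge0 ?addr_ge0 ?(ltW lam0) ?(ltW mu1_gt0)//=.
  by rewrite ltr_pdivrMr ?addr_gt0// mul1r ltrDl.
- move=> j; have := sojourn_laplace_step n (K + j) s0.
  rewrite /service_rate ifN; last by rewrite -ltnNge; lia.
  rewrite IH ?leq_addr// -addnS => rec.
  have q0 : 0 < lam + mu1 + s by rewrite -addrA addr_gt0.
  have -> : sojourn_laplace s (n.+1, (K + j)%N) - b ^+ n.+1 =
      lam / (lam + mu1 + s) *
      (sojourn_laplace s (n.+1, (K + j.+1)%N) - b ^+ n.+1).
    apply: (mulfI (lt0r_neq0 q0)); rewrite mulrBr rec exprS.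
    by rewrite /b; field; rewrite !gt_eqF.
  have lq0 : 0 <= lam / (lam + mu1 + s) by apply: divr_ge0; apply: ltW.
  rewrite normrM ler_wpM2r// ger0_norm// ler_wpM2l ?(ltW lam0)//.
  by rewrite lef_pV2 ?posrE// ?lerDl// addr_gt0.
- move=> j; have := sojourn_laplace_ge0 (n.+1, (K + j)%N) s0.
  have := sojourn_laplace_le1 (n.+1, (K + j)%N) s0.
  have : b ^+ n.+1 <= 1.
    by rewrite exprn_ile1// /b ler_pdivrMr// mul1r lerDl.
  have : 0 <= b ^+ n.+1 by rewrite exprn_ge0.
  by rewrite ler_norml; lra.
Qed.

End FirstStep.
End TaggedCustomer.

(** * Geometric sums of a bounded array with a two-term recursion *)

Section DiagonalSeries.
Context (R : realType) (lam mu s : R) (A : nat -> nat -> R).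
Hypotheses (lam0 : 0 < lam) (lam_mu : lam < mu) (s0 : 0 <= s).
Hypothesis A01 : forall n k, 0 <= A n k <= 1.
Hypothesis A_step : forall n k,
  (lam + mu + s) * A n.+1 k = mu * A n k + lam * A n.+1 k.+1.
Local Notation r := (lam / mu).

Let mu_gt0 : 0 < mu. Proof. exact: lt_trans lam_mu. Qed.
Let r_ge0 : 0 <= r. Proof. by apply: divr_ge0; apply: ltW. Qed.
Let r_lt1 : r < 1. Proof. by rewrite ltr_pdivrMr// mul1r. Qed.

Definition column_term (k n : nat) : R := r ^+ n * A n.+1 k.

Definition column_sum (k : nat) : R := limn (series (column_term k)).

Lemma column_term_ge0 k n : 0 <= column_term k n.
Proof. by rewrite mulr_ge0 ?exprn_ge0//; case/andP: (A01 n.+1 k). Qed.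

Lemma cvg_column k : cvgn (series (column_term k)).
Proof.
apply: (@series_le_cvg _ _ (geometric 1 r)).
- exact: column_term_ge0.
- by move=> n; rewrite /= mul1r exprn_ge0.
- move=> n; rewrite /= mul1r ler_piMr ?exprn_ge0//.
  by case/andP: (A01 n.+1 k).
- by apply: is_cvg_geometric_series; rewrite ger0_norm.
Qed.

(** Summing the recursion against [r ^+ n] shifts the index [n] on the first
    term and reproduces [lam * column_sum k]; this cancels the [lam] of the
    left-hand side, leaving a recursion in [k] alone. *)
Lemma column_sum_step k :
  (mu + s) * column_sum k = mu * A 0 k + lam * column_sum k.+1.
Proof.
(* The partial sums leave a boundary term, which the limit removes. *)
have fin N : (mu + s) * series (column_term k) N =
    mu * A 0 k - r ^+ N * (mu * A N k) + lam * series (column_term k.+1) N.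
  elim: N => [|N IH]; first by rewrite !seriesEnat/= !big_geq// expr0; ring.
  rewrite !seriesSr !mulrDr IH /column_term exprS.
  have -> : r * r ^+ N * (mu * A N.+1 k) = r ^+ N * (lam * A N.+1 k).
    by field; rewrite gt_eqF.
  have -> : mu * A N k = (lam + mu + s) * A N.+1 k - lam * A N.+1 k.+1.
    by rewrite A_step; ring.
  by ring.
have lhs : (mu + s) * series (column_term k) N @[N --> \oo] -->
    (mu + s) * column_sum k.
  by apply: cvgMl_tmp; exact: cvg_column.
suff rhs : (mu + s) * series (column_term k) N @[N --> \oo] -->
    mu * A 0 k + lam * column_sum k.+1.
  by rewrite -(cvg_lim _ lhs)// (cvg_lim _ rhs).
rewrite (eq_cvg _ _ fin).
apply: cvgD; last by apply: cvgMl_tmp; exact: cvg_column.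
rewrite -[X in _ --> X]subr0; apply: cvgB; first exact: cvg_cst.
apply: (@squeeze_cvgr _ _ _ _ (fun=> 0) (fun N => r ^+ N * mu)).
- apply: nearW => N; have /andP[a0 a1] := A01 N k.
  have rN : 0 <= r ^+ N by exact: exprn_ge0.
  have muA : 0 <= mu * A N k by rewrite mulr_ge0// ltW.
  by rewrite (mulr_ge0 rN muA)/= ler_wpM2l// ler_piMr// ltW.
- exact: cvg_cst.
- rewrite -[X in _ --> X](mul0r mu); apply: cvgMr_tmp; apply: cvg_expr.
  by rewrite ger0_norm.
Qed.

Lemma column_sum_expand M : let b := mu / (mu + s) in
  column_sum 0 = \sum_(0 <= h < M) r ^+ h * b ^+ h.+1 * A 0 h
                 + (r * b) ^+ M * column_sum M.
Proof.
move=> b; elim: M => [|M ->]; first by rewrite big_geq// add0r expr0 mul1r.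
rewrite big_nat_recr//= -addrA; congr (_ + _).
have q0 : mu + s != 0 by rewrite gt_eqF// ltr_wpDr.
have -> : column_sum M = b * A 0 M + r * b * column_sum M.+1.
  apply: (mulfI q0); rewrite column_sum_step /b; field.
  by rewrite q0 gt_eqF.
clearbody b; move: (lam / mu) => x.
by rewrite !exprMn !exprS; ring.
Qed.

Lemma column_sum_geometric (M k : nat) : let b := mu / (mu + s) in
  (forall n, A n.+1 k = b ^+ (M + n).+1) ->
  column_sum k = b ^+ M * (mu / (mu - lam + s)).
Proof.
move=> b Ab; have q0 : 0 < mu + s by rewrite ltr_wpDr.
have l0 : 0 < mu - lam + s by rewrite ltr_wpDr// subr_gt0.
have b0 : 0 <= b by apply: divr_ge0; apply: ltW.
have b1 : b <= 1 by rewrite ler_pdivrMr// mul1r lerDl.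
have rb : `|r * b| < 1.
  rewrite ger0_norm; last exact: mulr_ge0.
  by apply: le_lt_trans r_lt1; rewrite ler_piMr.
rewrite /column_sum (_ : column_term k = geometric (b ^+ M.+1) (r * b)).
  rewrite (cvg_lim _ (cvg_geometric_series rb))// exprSr /b; field.
  by rewrite !gt_eqF//= addrAC.
apply/funext => n; rewrite /column_term/= Ab -addSn exprD (exprMn n r).
by rewrite mulrCA mulrA.
Qed.

End DiagonalSeries.

(** * Mixtures of laws *)

Section Mixture.
Local Open Scope ereal_scope.
Context (R : realType) (d : measure_display) (Omega : measurableType d)
  (P : probability Omega R).

Lemma laplace_distribution (Z : {RV P >-> \bar R}) (s : R) :
  laplace Z s = \int[distribution P Z]_z expeR (- (s%:E * z)).
Proof.
rewrite ge0_integral_distribution//; first exact: (measurable_expeRN s (Z := id)).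
by move=> y; exact: expeR_ge0.
Qed.

Lemma laplace_mixture (p : nat -> R) (Z : nat -> {RV P >-> \bar R})
    (Zmix : {RV P >-> \bar R}) (s : R) :
  (forall n, (0 <= p n)%R) ->
  (forall B, measurable B -> distribution P Zmix B =
     \sum_(0 <= n <oo) (p n)%:E * distribution P (Z n) B) ->
  laplace Zmix s = \sum_(n <oo) (p n)%:E * laplace (Z n) s.
Proof.
move=> p0 mix.
have mE : measurable_fun setT (fun z : \bar R => expeR (- (s%:E * z))).
  exact: (measurable_expeRN s (Z := id)).
rewrite laplace_distribution.
rewrite (eq_measure_integral
    (mseries (fun n => mscale (NngNum (p0 n)) (distribution P (Z n))) 0)); last first.
  by move=> B mB _; exact: mix.
rewrite ge0_integral_measure_series//; last by move=> z _; exact: expeR_ge0.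
apply: eq_eseriesr => n _; rewrite ge0_integral_mscale ?laplace_distribution//.
by move=> z _; exact: expeR_ge0.
Qed.

Lemma EFin_series_lim (u : nat -> R) : cvgn (series u) ->
  \sum_(n <oo) (u n)%:E = (limn (series u))%:E.
Proof.
move=> cu; rewrite -EFin_lim//; congr (limn _); apply/funext => n /=.
by rewrite -sumEFin.
Qed.

End Mixture.

(** * The stationary sojourn time *)

Theorem proposition2p2 (R : realType) (lam mu0 mu1 : R) (K : nat)
  (hlam : 0 < lam) (hmu0 : 0 < mu0) (hmu : mu0 < mu1) (hK : (1 <= K)%N)
  (hstab : lam < mu1)
  (d : measure_display) (Omega : measurableType d) (P : probability Omega R)
  (S : nat -> nat -> {RV P >-> \bar R})
  (hS : forall n m, remaining_sojourn_time lam mu0 mu1 K n m (S n m))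
  (Sstar : {RV P >-> \bar R})
  (hSstar : stationary_sojourn_time lam mu0 mu1 K S Sstar)
  (s : R) (hs : 0 <= s) :
  let psi n m := laplace (S n m) s in
  let p0 := pi0 lam mu0 mu1 K in
  (laplace Sstar s =
   p0%:E * \sum_(0 <= h < K)
     (((lam / mu0) ^+ h)%:E * psi h.+1 0%N
      + ((lam / mu0) ^+ K * (lam / mu1) ^+ h
         * (mu1 / (mu1 + s)) ^+ h.+1)%:E * psi K h)
   + (p0 * (lam / mu0) ^+ K * (lam / mu1) ^+ K * (mu1 / (mu1 - lam))
      * (mu1 / (mu1 + s)) ^+ (2 * K)
      * ((mu1 - lam) / (mu1 - lam + s)))%:E)%E.
Proof.
move=> psi p0.
have mu1_gt0 : 0 < mu1 by exact: lt_trans hlam hstab.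
have mass_le1 x : (\sum_(k <oo) (sojourn_term lam mu0 mu1 K 0 k x)%:E <= 1)%E.
  case: x => n m; have [X [[Y [T [law _]]] _]] := hS n m.
  exact: (hitting_mass_le1 hlam hmu0 mu1_gt0 law).
pose F := sojourn_laplace lam mu0 mu1 K s.
have psiE n m : psi n m = (F (n, m))%:E.
  have [X [[Y [T [law XY]]] SX]] := hS n m.
  rewrite /psi (laplace_hitting_time hlam hmu0 mu1_gt0 law hs _ XY SX).
    by rewrite sojourn_laplaceE.
  by rewrite sojourn_laplaceE// sojourn_laplace_s0.
pose A n k := F ((K + n)%N, k).
have A01 n k : 0 <= A n k <= 1.
  by rewrite sojourn_laplace_ge0//= sojourn_laplace_le1.
have A_step n k : (lam + mu1 + s) * A n.+1 k = mu1 * A n k + lam * A n.+1 k.+1.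
  have := sojourn_laplace_step hlam hmu0 mu1_gt0 mass_le1 (K + n) k hs.
  by rewrite /A addnS /service_rate ifN//; rewrite -ltnNge; lia.
rewrite (laplace_mixture s (stat_dist_ge0 K hlam hmu0 hstab) hSstar).
(* From n = K on, the stationary weights are geometric of ratio lam / mu1. *)
have tail n : stat_dist lam mu0 mu1 K (K + n) * F ((K + n).+1, 0%N) =
    p0 * (lam / mu0) ^+ K * column_term lam mu1 A 0 n.
  rewrite /column_term /A addnS mulrA; congr (_ * _); rewrite /stat_dist -/p0.
  case: n => [|n]; first by rewrite addn0 leqnn expr0 mulr1 mulrC.
  rewrite ifN; last by rewrite -ltnNge; lia.
  have -> : (lam / mu0) ^+ K = (mu1 / mu0) ^+ K * (lam / mu1) ^+ K.
    by rewrite -exprMn; congr (_ ^+ _); field; rewrite !gt_eqF.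
  by rewrite exprD; ring.
have F0 n : (0 <= (stat_dist lam mu0 mu1 K n)%:E * psi n.+1 0%N)%E.
  by rewrite psiE -EFinM lee_fin mulr_ge0// ?stat_dist_ge0// sojourn_laplace_ge0.
(* Arrivals who find fewer than K customers give the first sum as it stands. *)
rewrite (nneseries_split 0 K) => [|k _]; last exact: F0.
rewrite add0n -(nneseries_addn K)//.
have -> : (\sum_(0 <= i <oo) (stat_dist lam mu0 mu1 K (i + K))%:E
      * laplace (S (i + K).+1 0%N) s)%E =
    (p0 * (lam / mu0) ^+ K * column_sum lam mu1 A 0)%:E.
  rewrite EFinM -EFin_series_lim; last exact: cvg_column.
  rewrite -nneseriesZl//; last by move=> i _; rewrite lee_fin column_term_ge0.
  by apply: eq_eseriesr => n _; rewrite -/(psi _ _) psiE -!EFinM addnC tail.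
have Kcol n : A n.+1 K = (mu1 / (mu1 + s)) ^+ (K + n).+1.
  by rewrite /A /F sojourn_laplace_geometric// addnS.
rewrite (column_sum_expand hlam hstab hs A01 A_step K).
rewrite (column_sum_geometric hlam hstab hs Kcol).
rewrite (eq_big_nat _ _ (F2 := fun h =>
    (p0 * ((lam / mu0) ^+ h * F (h.+1, 0%N)))%:E)); last first.
  move=> h /andP[_ hK']; rewrite -/(psi _ _) psiE -EFinM /stat_dist ltnW//.
  by congr EFin; rewrite -/p0; ring.
under [in RHS]eq_big_nat do rewrite !psiE -!EFinM -EFinD.
rewrite !sumEFin -EFinM -!EFinD; congr EFin.
rewrite big_split/= [in RHS]mulrDr -!mulr_sumr -!addrA; congr (_ + _).
rewrite [in LHS]mulrDr; congr (_ + _).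
  rewrite -mulrA; congr (_ * _); rewrite mulr_sumr; apply: eq_bigr => h _.
  by rewrite /A addn0 !mulrA.
rewrite mul2n -addnn exprD (exprMn K (lam / mu1)).
move: ((lam / mu0) ^+ K) ((lam / mu1) ^+ K) ((mu1 / (mu1 + s)) ^+ K) => x y z.
have ml : mu1 - lam != 0 by rewrite gt_eqF// subr_gt0.
have mls : mu1 + (- lam + s) != 0 by rewrite addrA gt_eqF// ltr_wpDr// subr_gt0.
by field; rewrite ml mls.
Qed.
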